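(* Let $0<t<\pi/2$ and let $$f_\infty(z)=\int_0^z\bigl(1-2(\cos 2t)\zeta^2+\zeta^4\bigr)^{-1/2}\,d\zeta,\qquad z\in\mathbb{D}.$$ Set $\lambda_\infty=\tfrac14\cot 2t$. Then the Schwarzian derivative of $f_\infty$ is $\mathcal{S}_{f_\infty}=R_{t,\lambda_\infty}=2\psi_0-2\lambda_\infty\psi_1$. The function $$y_\infty(z)=(f_\infty'(z))^{-1/2}=\bigl(1-2(\cos2t)z^2+z^4\bigr)^{1/4}$$ never vanishes in $\mathbb{D}$ and satisfies $$y_\infty''+\psi_0\,y_\infty=\lambda_\infty\psi_1\,y_\infty,\qquad y_\infty(0)=1,\qquad y_\infty'(0)=0,$$ as well as $$y_\infty(1)=\sqrt{2\sin t},\qquad y_\infty'(1)=\sqrt{\tfrac{\sin t}{2}},$$ so that it satisfies the boundary condition $y_\infty(1)^2-2y_\infty(1)y_\infty'(1)=\kappa_\infty$ with $\kappa_\infty=0$.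
   Context: $\mathbb{D}$ is the open unit disk; the branches of the powers are those equal to $1$ at $z=0$ (and positive on $[0,1]$). The Schwarzian derivative is $\mathcal{S}_f=(f''/f')'-\tfrac12(f''/f')^2$. With $a=e^{it}$, $$\psi_0(z)=\frac34\left(\frac{a^2}{(z^2-a^2)^2}+\frac{\overline a^2}{(z^2-\overline a^2)^2}\right),\qquad \psi_1(z)=-i\left(\frac1{z^2-a^2}-\frac1{z^2-\overline a^2}\right)=\frac{2\sin 2t}{z^4-2(\cos 2t)z^2+1}.$$ *)

(* Defs.v *)
From Stdlib Require Import Reals ClassicalEpsilon.
From Coquelicot Require Import Coquelicot.
Open Scope R_scope.

Definition Cexp (z : C) : C :=
  (exp (Re z) * cos (Im z), exp (Re z) * sin (Im z)).

Definition in_disk (z : C) : Prop := Cmod z < 1.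

Definition C_differentiable_at (f : C -> C) (z : C) : Prop :=
  @ex_derive C_AbsRing C_NormedModule f z.

(** Integral along the straight segment from [0] to [z]. *)
Definition segment_integral (g : C -> C) (z : C) : C :=
  (z * RInt (V := C_R_CompleteNormedModule) (fun s : R => g (RtoC s * z)) 0 1)%C.

(** The Schwarzian derivative [(f''/f')' - (f''/f')^2 / 2]. *)
Definition schwarzian (f : C -> C) (z : C) : C :=
  (C_derive (fun w => C_derive (C_derive f) w / C_derive f w) z
   - 1 / 2 * (C_derive (C_derive f) z / C_derive f z) ^ 2)%C.

(** [h] is, on [U], the branch of [g ^ alpha] with value [1] at [0]:
    [exp (alpha * L)] for a continuous logarithm [L] of [g] on [U].  If [U] is
    connected and contains [0], these conditions determine [h] on [U]. *)
Definition is_power_branch (U : C -> Prop) (g : C -> C) (alpha : R) (h : C -> C)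
  : Prop :=
  (exists L : C -> C,
      continuous_on (T := C_UniformSpace) (U := C_UniformSpace) U L /\
      (forall z, U z -> Cexp (L z) = g z) /\
      (forall z, U z -> h z = Cexp (RtoC alpha * L z)%C)) /\
  h (RtoC 0) = RtoC 1.

(** The values outside [U] are arbitrary; if there is no branch, the whole
    function is an unspecified one. *)
Definition power_branch (U : C -> Prop) (g : C -> C) (alpha : R) : C -> C :=
  epsilon (inhabits (fun _ : C => RtoC 0)) (is_power_branch U g alpha).

Definition quartic (t : R) (z : C) : C :=
  (1 - 2 * RtoC (cos (2 * t)) * z ^ 2 + z ^ 4)%C.

(** The points visible from [0] past the zeros of [quartic t].  These zeros are
    [e^(it)], [e^(-it)] and their opposites, so for [0 < t < PI/2] this is an
    open star-shaped set containing the open disk and the segment [[0,1]]; in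
    particular [1] is an interior point, which gives a meaning to values and
    derivatives there.  On [[0,1]] the quartic is positive, hence so are its
    powers taken in the branch equal to [1] at [0]. *)
Definition star_domain (t : R) (z : C) : Prop :=
  forall s : R, 0 <= s <= 1 -> quartic t (RtoC s * z)%C <> RtoC 0.

Definition quartic_power (t alpha : R) : C -> C :=
  power_branch (star_domain t) (quartic t) alpha.

Definition f_inf (t : R) : C -> C :=
  segment_integral (quartic_power t (- (1 / 2))).

Definition y_inf (t : R) : C -> C :=
  power_branch (star_domain t) (C_derive (f_inf t)) (- (1 / 2)).

Definition lambda_inf (t : R) : R := 1 / 4 * (cos (2 * t) / sin (2 * t)).

Definition kappa_inf : R := 0.

Definition unit_a (t : R) : C := Cexp (Ci * RtoC t)%C.

Definition psi0 (t : R) (z : C) : C :=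
  (3 / 4 * (unit_a t ^ 2 / (z ^ 2 - unit_a t ^ 2) ^ 2
            + Cconj (unit_a t) ^ 2 / (z ^ 2 - Cconj (unit_a t) ^ 2) ^ 2))%C.

Definition psi1 (t : R) (z : C) : C :=
  (- Ci * (1 / (z ^ 2 - unit_a t ^ 2) - 1 / (z ^ 2 - Cconj (unit_a t) ^ 2)))%C.

Definition R_function (t lambda : R) (z : C) : C :=
  (2 * psi0 t z - 2 * RtoC lambda * psi1 t z)%C.

(* Main.v *)
Require Import Defs.
From Stdlib Require Import Reals Lra ClassicalEpsilon.
From Coquelicot Require Import Coquelicot.
Open Scope R_scope.

(** Let [q] be the quartic.  On a star-shaped open set a holomorphic function has
    the primitive given by the integral along segments from [0]
    ([segment_integral_primitive]).  Applied to [q' / q] on the star domain of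
    [q], this gives a holomorphic logarithm [L] of [q] with [L 0 = 0]
    ([segment_integral_log]).  Two continuous logarithms differ by a continuous
    function with values in [2 pi i Z], hence by a constant, so the branch of
    [q ^ alpha] equal to [1] at [0] is [exp (alpha L)], whatever logarithm was
    used to define it ([power_branch_eq]).  A second use of the primitive lemma
    gives [f_inf' = exp (- L / 2)]; then [- L / 2] is a logarithm of [f_inf']
    vanishing at [0], and [y_inf = exp (L / 4)].

    The differential statements now follow from [L' = q' / q]:
    [f_inf'' / f_inf' = - q' / (2 q)], [y_inf' = q' / (4 q) y_inf], and
    [y_inf'' = - (S / 2) y_inf], where [S] is the Schwarzian of [f_inf].  That [S]
    is [2 psi0 - 2 lambda psi1] is an identity of rational functions, which rests
    on [q = (z ^ 2 - a ^ 2) (z ^ 2 - conj a ^ 2)], [a ^ 2 conj a ^ 2 = 1] and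
    [a ^ 2 + conj a ^ 2 = 2 cos 2t].

    At [1], the integral defining [L] has a real integrand, so [L 1] is the real
    logarithm of [q 1 = (2 sin t) ^ 2] and [y_inf 1 = sqrt (2 sin t)].  Since
    [q' 1 = 2 q 1], [y_inf' 1 = y_inf 1 / 2], which is both the value of the
    derivative and the boundary condition. *)

(** * Complex derivatives *)

Local Notation is_Cderive f z l :=
  (@is_derive C_AbsRing C_NormedModule f z l).
Local Notation C_continuous f z :=
  (@continuous C_UniformSpace C_UniformSpace f z).
(** The topology of the target is fixed because [C] carries two uniform
    structures, the product one and the one of its modulus; they have the same
    neighbourhoods but are not convertible. *)
Local Notation continuous_to_C f x :=
  (@continuous _ C_UniformSpace f x).

(** The product and chain rules need [C] as target in its capacity as an absolute
    ring; this has the norm of [C_NormedModule] and an equivalent uniform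
    structure, so only the linearity of the differential is to be proved again. *)
Lemma is_Cderive_AbsRing (f : C -> C) (z l : C) :
  is_Cderive f z l <->
  @is_derive C_AbsRing (AbsRing_NormedModule C_AbsRing) f z l.
Proof.
  split; intros [_ H]; split; try exact H.
  - apply (@is_linear_scal_l C_AbsRing (AbsRing_NormedModule C_AbsRing)).
  - apply (@is_linear_scal_l C_AbsRing C_NormedModule).
Qed.

Lemma locally_Cmod (z : C) (P : C -> Prop) :
  @locally C_UniformSpace z P <->
  exists d : R, 0 < d /\ forall w, Cmod (w - z) < d -> P w.
Proof.
  split.
  - intros H. apply locally_C in H. destruct H as [d Hd].
    exists d. split; [apply cond_pos | exact Hd].
  - intros [d [Hd H]]. apply locally_C. exists (mkposreal d Hd). exact H.
Qed.

Lemma is_Cderive_Cmod (f : C -> C) (z l : C) :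
  is_Cderive f z l <->
  forall eps, 0 < eps -> exists d, 0 < d /\ forall w, Cmod (w - z) < d ->
    Cmod (f w - f z - (w - z) * l) <= eps * Cmod (w - z).
Proof.
  rewrite is_Cderive_AbsRing. split.
  - intros [_ H] eps Heps.
    destruct (H z (fun P HP => HP) (mkposreal eps Heps)) as [d Hd].
    exists d. split; [apply cond_pos | exact Hd].
  - intros H. split.
    + apply (@is_linear_scal_l C_AbsRing (AbsRing_NormedModule C_AbsRing)).
    + intros x Hx.
      apply (is_filter_lim_locally_unique (V := AbsRing_NormedModule C_AbsRing))
        in Hx.
      subst x. intros eps.
      destruct (H eps (cond_pos eps)) as [d [Hd Hw]].
      exists (mkposreal d Hd). exact Hw.
Qed.

Lemma is_Cderive_continuous (f : C -> C) (z l : C) :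
  is_Cderive f z l -> C_continuous f z.
Proof.
  intros H P HP. apply locally_C.
  apply (ex_derive_continuous (V := C_NormedModule) f z (ex_intro _ l H) P HP).
Qed.

Lemma is_Cderive_const (c z : C) : is_Cderive (fun _ => c) z (RtoC 0).
Proof. exact (@is_derive_const C_AbsRing C_NormedModule c z). Qed.

Lemma is_Cderive_id (z : C) : is_Cderive (fun w => w) z (RtoC 1).
Proof. apply is_Cderive_AbsRing, (@is_derive_id C_AbsRing z). Qed.

Lemma is_Cderive_plus (f g : C -> C) (z a b : C) :
  is_Cderive f z a -> is_Cderive g z b ->
  is_Cderive (fun w => f w + g w)%C z (a + b)%C.
Proof. exact (@is_derive_plus C_AbsRing C_NormedModule f g z a b). Qed.

Lemma is_Cderive_mult (f g : C -> C) (z a b : C) :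
  is_Cderive f z a -> is_Cderive g z b ->
  is_Cderive (fun w => f w * g w)%C z (a * g z + f z * b)%C.
Proof.
  rewrite !is_Cderive_AbsRing. intros Hf Hg.
  exact (@is_derive_mult C_AbsRing f g z a b Hf Hg Cmult_comm).
Qed.

Lemma is_Cderive_scal (c : C) (f : C -> C) (z a : C) :
  is_Cderive f z a -> is_Cderive (fun w => c * f w)%C z (c * a)%C.
Proof.
  intros H. replace (c * a)%C with (RtoC 0 * f z + c * a)%C by ring.
  exact (is_Cderive_mult (fun _ => c) f z _ _ (is_Cderive_const c z) H).
Qed.

Lemma is_Cderive_comp (f g : C -> C) (z a b : C) :
  is_Cderive f (g z) a -> is_Cderive g z b ->
  is_Cderive (fun w => f (g w)) z (b * a)%C.
Proof.
  rewrite (is_Cderive_AbsRing g). intros Hf Hg.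
  exact (@is_derive_comp C_AbsRing C_NormedModule f g z a b Hf Hg).
Qed.

Lemma is_Cderive_ext_loc (f g : C -> C) (z l : C) :
  @locally C_UniformSpace z (fun w => f w = g w) ->
  is_Cderive f z l -> is_Cderive g z l.
Proof.
  intros H. apply is_derive_ext_loc. apply locally_C. exact H.
Qed.

Lemma is_Cderive_ext (f g : C -> C) (z l : C) :
  (forall w, f w = g w) -> is_Cderive f z l -> is_Cderive g z l.
Proof. intros H. apply is_Cderive_ext_loc, filter_forall, H. Qed.

Lemma is_Cderive_inv (z : C) : z <> RtoC 0 ->
  is_Cderive Cinv z (- / (z * z))%C.
Proof.
  intros Hz. apply is_Cderive_Cmod. intros eps Heps.
  assert (Hm : 0 < Cmod z) by (apply Cmod_gt_0; exact Hz).
  set (m := Cmod z) in *.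
  exists (Rmin (m / 2) (eps * m ^ 3 / 2)). split.
  { apply Rmin_pos; [lra|]. apply Rdiv_lt_0_compat; [|lra].
    apply Rmult_lt_0_compat; [lra|]. apply pow_lt; lra. }
  intros w Hw.
  assert (H1 : Cmod (w - z) < m / 2) by (eapply Rlt_le_trans; [exact Hw|apply Rmin_l]).
  assert (H2 : Cmod (w - z) < eps * m ^ 3 / 2)
    by (eapply Rlt_le_trans; [exact Hw|apply Rmin_r]).
  assert (Hmw : m / 2 < Cmod w).
  { assert (m <= Cmod w + Cmod (w - z)).
    { unfold m. replace z with (w + - (w - z))%C at 1 by ring.
      eapply Rle_trans; [apply Cmod_triangle|]. rewrite Cmod_opp. lra. }
    lra. }
  assert (Hw0 : w <> RtoC 0) by (intros E; rewrite E, Cmod_0 in Hmw; lra).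
  replace (/ w - / z - (w - z) * - / (z * z))%C
    with ((w - z) * ((w - z) * / (w * (z * z))))%C by (field; auto).
  rewrite !Cmod_mult, Cmod_inv by (repeat apply Cmult_neq_0; auto).
  rewrite !Cmod_mult. fold m. rewrite (Rmult_comm eps).
  apply Rmult_le_compat_l; [apply Cmod_ge_0|].
  apply Rmult_le_reg_r with (Cmod w * (m * m)); [repeat apply Rmult_lt_0_compat; lra|].
  rewrite Rmult_assoc, Rinv_l, Rmult_1_r
    by (apply Rgt_not_eq; repeat apply Rmult_lt_0_compat; lra).
  assert (eps * (m * m) * (m / 2) <= eps * (m * m) * Cmod w).
  { apply Rmult_le_compat_l; [|lra]. repeat apply Rmult_le_pos; lra. }
  nra.
Qed.

Lemma is_Cderive_div (f g : C -> C) (z a b : C) : g z <> RtoC 0 ->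
  is_Cderive f z a -> is_Cderive g z b ->
  is_Cderive (fun w => f w / g w)%C z ((a * g z - f z * b) / (g z) ^ 2)%C.
Proof.
  intros H0 Hf Hg.
  replace ((a * g z - f z * b) / (g z) ^ 2)%C
    with (a * / g z + f z * (b * - / (g z * g z)))%C by (field; auto).
  apply (is_Cderive_mult f (fun w => / g w)%C); [exact Hf|].
  exact (is_Cderive_comp Cinv g z _ _ (is_Cderive_inv (g z) H0) Hg).
Qed.

Lemma Cexp_plus (z w : C) : Cexp (z + w) = (Cexp z * Cexp w)%C.
Proof.
  unfold Cexp, Re, Im, Cmult, Cplus; simpl.
  rewrite exp_plus, cos_plus, sin_plus. f_equal; ring.
Qed.

Lemma Cexp_RtoC (x : R) : Cexp (RtoC x) = RtoC (exp x).
Proof.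
  unfold Cexp, RtoC, Re, Im; simpl. rewrite cos_0, sin_0. f_equal; ring.
Qed.

Lemma Cexp_0 : Cexp (RtoC 0) = RtoC 1.
Proof. rewrite Cexp_RtoC, exp_0. reflexivity. Qed.

Lemma Cexp_neq_0 (z : C) : Cexp z <> RtoC 0.
Proof.
  intros H. assert (E : (Cexp z * Cexp (- z))%C = RtoC 1).
  { rewrite <- Cexp_plus. replace (z + - z)%C with (RtoC 0) by ring. apply Cexp_0. }
  rewrite H, Cmult_0_l in E. injection E. lra.
Qed.

Lemma Cmod_le_parts (z : C) : Cmod z <= Rabs (fst z) + Rabs (snd z).
Proof.
  replace z with (RtoC (fst z) + Ci * RtoC (snd z))%C at 1.
  - eapply Rle_trans; [apply Cmod_triangle|].
    rewrite Cmod_mult, !Cmod_R.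
    replace (Cmod Ci) with 1; [lra|]. unfold Cmod, Ci; simpl.
    replace (0 * (0 * 1) + 1 * (1 * 1)) with 1 by ring. symmetry; apply sqrt_1.
  - destruct z; unfold RtoC, Ci, Cplus, Cmult; simpl. f_equal; ring.
Qed.

Lemma is_derive_small (f : R -> R) (l eps : R) : is_derive f 0 l -> 0 < eps ->
  exists d, 0 < d /\ forall x, Rabs x < d ->
    Rabs (f x - f 0 - l * x) <= eps * Rabs x.
Proof.
  intros [_ H] He.
  destruct (H 0 (fun P HP => HP) (mkposreal eps He)) as [d Hd].
  exists d. split; [apply cond_pos|]. intros x Hx.
  specialize (Hd x). unfold ball, minus, scal, norm, plus, opp in Hd.
  simpl in Hd. unfold AbsRing_ball, abs, minus, plus, opp, scal, mult in Hd.
  simpl in Hd. unfold mult in Hd; simpl in Hd.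
  replace (x + - 0) with x in Hd by ring.
  replace (f x - f 0 - l * x) with (f x + - f 0 + - (x * l)) by ring. auto.
Qed.

(** With [w = x + iy], the real part of [exp w - 1 - w] is
    [(exp x - 1 - x) + exp x (cos y - 1)] and the imaginary part is
    [exp x (sin y - y) + (exp x - 1) y]; each term is controlled by a real
    derivative at [0]. *)
Lemma is_Cderive_Cexp_0 : is_Cderive Cexp (RtoC 0) (RtoC 1).
Proof.
  apply is_Cderive_Cmod. intros eps Heps.
  (* The terms are at most [e |x|], [3 e |y|], [3 e |y|] and [2 |x| |y|], the [3]
     bounding [exp x]; with [|x|, |y| <= |w| < eps / 16] their sum is at most
     [9 / 16 eps |w|]. *)
  set (e := Rmin (eps / 16) 1).
  assert (He : 0 < e) by (apply Rmin_pos; lra).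
  assert (He1 : e <= 1) by apply Rmin_r.
  assert (He2 : e <= eps / 16) by apply Rmin_l.
  destruct (is_derive_small exp 1 e) as [d1 [Hd1 H1]]; [|exact He|].
  { rewrite <- exp_0. apply is_derive_exp. }
  destruct (is_derive_small cos 0 e) as [d2 [Hd2 H2]]; [|exact He|].
  { pose proof (is_derive_cos 0) as H. rewrite sin_0, Ropp_0 in H. exact H. }
  destruct (is_derive_small sin 1 e) as [d3 [Hd3 H3]]; [|exact He|].
  { rewrite <- cos_0. apply is_derive_sin. }
  exists (Rmin (Rmin d1 d2) (Rmin d3 (Rmin (eps / 16) 1))). split.
  { repeat apply Rmin_pos; lra. }
  intros w Hw. replace (w - RtoC 0)%C with w in * by ring.
  assert (Hd : Cmod w < d1 /\ Cmod w < d2 /\ Cmod w < d3 /\ Cmod w < eps / 16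
               /\ Cmod w < 1).
  { repeat split; (eapply Rlt_le_trans; [exact Hw|]);
      unfold Rmin; repeat destruct Rle_dec; lra. }
  destruct w as [x y].
  pose proof (Rmax_Cmod (x, y)) as Hm. simpl in Hm.
  pose proof (Rmax_l (Rabs x) (Rabs y)). pose proof (Rmax_r (Rabs x) (Rabs y)).
  set (m := Cmod (x, y)) in *.
  specialize (H1 x ltac:(lra)). specialize (H2 y ltac:(lra)).
  specialize (H3 y ltac:(lra)).
  rewrite exp_0 in H1. rewrite cos_0 in H2. rewrite sin_0 in H3.
  rewrite Cexp_0. eapply Rle_trans; [apply Cmod_le_parts|].
  unfold Cexp, RtoC, Re, Im, Cminus, Cplus, Copp, Cmult; simpl.
  set (E := exp x) in *.
  assert (HE : Rabs (E - 1) <= 2 * Rabs x).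
  { replace (E - 1) with ((E - 1 - 1 * x) + x) by ring.
    eapply Rle_trans; [apply Rabs_triang|]. pose proof (Rabs_pos x). nra. }
  assert (HE3 : 0 < E <= 3).
  { split; [apply exp_pos|]. pose proof (Rle_abs (E - 1)). lra. }
  assert (A1 : Rabs (E * cos y + - (1) + - (x * 1 - y * 0)) <= e * Rabs x + 3 * (e * Rabs y)).
  { replace (E * cos y + - (1) + - (x * 1 - y * 0))
      with ((E - 1 - 1 * x) + E * (cos y - 1 - 0 * y)) by ring.
    eapply Rle_trans; [apply Rabs_triang|]. apply Rplus_le_compat; [exact H1|].
    rewrite Rabs_mult, (Rabs_pos_eq E) by lra.
    apply Rmult_le_compat; try apply Rabs_pos; lra. }
  assert (A2 : Rabs (E * sin y + - 0 + - (x * 0 + y * 1)) <= 3 * (e * Rabs y) + 2 * Rabs x * Rabs y).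
  { replace (E * sin y + - 0 + - (x * 0 + y * 1))
      with (E * (sin y - 0 - 1 * y) + (E - 1) * y) by ring.
    eapply Rle_trans; [apply Rabs_triang|]. apply Rplus_le_compat.
    - rewrite Rabs_mult, (Rabs_pos_eq E) by lra.
      apply Rmult_le_compat; try apply Rabs_pos; lra.
    - rewrite Rabs_mult. apply Rmult_le_compat_r; [apply Rabs_pos|lra]. }
  pose proof (Rabs_pos x). pose proof (Rabs_pos y).
  assert (Rabs x * Rabs y <= eps / 16 * m) by (apply Rmult_le_compat; lra).
  assert (e * Rabs x <= eps / 16 * m) by (apply Rmult_le_compat; lra).
  assert (e * Rabs y <= eps / 16 * m) by (apply Rmult_le_compat; lra).
  assert (0 <= eps * m) by nra.
  lra.
Qed.

Lemma is_Cderive_Cexp (z : C) : is_Cderive Cexp z (Cexp z).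
Proof.
  apply is_Cderive_Cmod. intros eps Heps.
  assert (Hc : 0 < Cmod (Cexp z)) by apply Cmod_gt_0, Cexp_neq_0.
  destruct (proj1 (is_Cderive_Cmod _ _ _) is_Cderive_Cexp_0 (eps / Cmod (Cexp z)))
    as [d [Hd H]].
  { apply Rdiv_lt_0_compat; lra. }
  exists d. split; [exact Hd|]. intros w Hw.
  specialize (H (w - z)%C).
  replace (w - z - RtoC 0)%C with (w - z)%C in H by ring. specialize (H Hw).
  rewrite Cexp_0 in H.
  replace (Cexp w - Cexp z - (w - z) * Cexp z)%C
    with (Cexp z * (Cexp (w - z) - RtoC 1 - (w - z) * RtoC 1))%C.
  - rewrite Cmod_mult.
    replace (eps * Cmod (w - z))
      with (Cmod (Cexp z) * (eps / Cmod (Cexp z) * Cmod (w - z))) by (field; lra).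
    apply Rmult_le_compat_l; [lra|exact H].
  - replace w with (z + (w - z))%C at 3 by ring. rewrite Cexp_plus. ring.
Qed.

Lemma is_Cderive_Cexp_comp (f : C -> C) (z a : C) :
  is_Cderive f z a -> is_Cderive (fun w => Cexp (f w)) z (a * Cexp (f z))%C.
Proof. exact (is_Cderive_comp Cexp f z _ _ (is_Cderive_Cexp (f z))). Qed.

(** * Continuity, and restriction to real lines *)

Lemma continuous_C_AbsRing {T : UniformSpace} (f : T -> C) (x : T) :
  continuous_to_C f x <-> @continuous T (AbsRing_UniformSpace C_AbsRing) f x.
Proof.
  split; intros H P HP; apply H; apply locally_C; exact HP.
Qed.

Lemma continuous_Cmult {T : UniformSpace} (f g : T -> C) (x : T) :
  continuous_to_C f x -> continuous_to_C g x -> continuous_to_C (fun y => f y * g y)%C x.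
Proof.
  rewrite !continuous_C_AbsRing. exact (@continuous_mult T C_AbsRing f g x).
Qed.

Lemma continuous_Cplus {T : UniformSpace} (f g : T -> C) (x : T) :
  continuous_to_C f x -> continuous_to_C g x -> continuous_to_C (fun y => f y + g y)%C x.
Proof. exact (@continuous_plus T C_AbsRing C_NormedModule f g x). Qed.

Lemma continuous_RtoC {T : UniformSpace} (r : T -> R) (x : T) :
  continuous r x -> continuous_to_C (fun y => RtoC (r y)) x.
Proof.
  intros H. apply (continuous_comp_2 r (fun _ => 0) (fun a b => (a, b) : C)).
  - exact H.
  - apply continuous_const.
  - intros P [d HP]. exists d. intros [a b] Hab. exact (HP (a, b) Hab).
Qed.

Lemma continuous_ray (w : C) (s : R) :
  @continuous R_UniformSpace C_UniformSpace (fun u => RtoC u * w)%C s.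
Proof.
  apply (continuous_Cmult (fun u => RtoC u) (fun _ => w)); [|apply continuous_const].
  apply continuous_RtoC, continuous_id.
Qed.

Lemma continuous_Re {T : UniformSpace} (f : T -> C) (x : T) :
  continuous_to_C f x -> continuous (fun y => fst (f y)) x.
Proof.
  intros H. apply (continuous_comp (V := C_UniformSpace) f fst _ H).
  destruct (f x) as [a b].
  apply (@continuous_fst R_UniformSpace R_UniformSpace a b).
Qed.

(** The link between complex and real differentiation: a holomorphic function
    restricted to a real line through [z] in the direction [v]. *)
Lemma is_derive_along (f : C -> C) (z v l : C) (x : R) :
  is_Cderive f (z + RtoC x * v)%C l ->
  @is_derive R_AbsRing C_R_NormedModule
    (fun u : R => f (z + RtoC u * v)%C) x (v * l)%C.
Proof.
  intros H. split; [apply is_linear_scal_l|].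
  intros x' Hx'. apply (is_filter_lim_locally_unique (V := R_NormedModule)) in Hx'.
  subst x'. intros [eps Heps].
  assert (Hv : 0 <= Cmod v) by apply Cmod_ge_0.
  destruct (proj1 (is_Cderive_Cmod _ _ _) H (eps / (Cmod v + 1))) as [d [Hd Hf]].
  { apply Rdiv_lt_0_compat; lra. }
  assert (Hd' : 0 < d / (Cmod v + 1)) by (apply Rdiv_lt_0_compat; lra).
  exists (mkposreal _ Hd'). intros u Hu.
  assert (Hux : Rabs (u - x) < d / (Cmod v + 1)) by exact Hu. clear Hu.
  assert (Hdist : Cmod (z + RtoC u * v - (z + RtoC x * v)) = Rabs (u - x) * Cmod v).
  { replace (z + RtoC u * v - (z + RtoC x * v))%C with (RtoC (u - x) * v)%C
      by (rewrite RtoC_minus; ring).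
    rewrite Cmod_mult, Cmod_R. reflexivity. }
  assert (Hlt : Rabs (u - x) * (Cmod v + 1) < d).
  { apply (Rmult_lt_compat_r (Cmod v + 1)) in Hux; [|lra].
    unfold Rdiv in Hux. rewrite Rmult_assoc, Rinv_l, Rmult_1_r in Hux; lra. }
  pose proof (Rabs_pos (u - x)) as Hp.
  specialize (Hf (z + RtoC u * v)%C). rewrite Hdist in Hf.
  specialize (Hf ltac:(nra)).
  change (norm (minus u x)) with (Rabs (u - x)).
  rewrite <- Cmod_norm.
  match goal with |- Cmod ?a <= _ =>
    replace a with (f (z + RtoC u * v) - f (z + RtoC x * v)
      - (z + RtoC u * v - (z + RtoC x * v)) * l)%C end.
  - eapply Rle_trans; [exact Hf|]. simpl.
    replace (eps / (Cmod v + 1) * (Rabs (u - x) * Cmod v))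
      with (eps * Rabs (u - x) * (Cmod v / (Cmod v + 1))) by (field; lra).
    rewrite <- (Rmult_1_r (eps * Rabs (u - x))) at 2.
    apply Rmult_le_compat_l; [nra|].
    apply Rmult_le_reg_r with (Cmod v + 1); [lra|]. unfold Rdiv.
    rewrite Rmult_assoc, Rinv_l by lra. lra.
  - replace (z + RtoC u * v - (z + RtoC x * v))%C with (RtoC (u - x) * v)%C
      by (rewrite RtoC_minus; ring).
    destruct (f (z + RtoC u * v)%C) as [a b], (f (z + RtoC x * v)%C) as [a' b'],
      v as [v1 v2], l as [l1 l2].
    unfold minus, plus, opp, scal; simpl.
    unfold prod_plus, prod_opp, prod_scal, minus, plus, opp, scal, RtoC, Cminus,
      Cplus, Copp, Cmult; simpl. unfold mult; simpl.
    f_equal; ring.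
Qed.

Lemma is_derive_Re (phi : R -> C) (x : R) (l : C) :
  @is_derive R_AbsRing C_R_NormedModule phi x l ->
  is_derive (fun u => fst (phi u)) x (fst l).
Proof.
  intros H.
  apply (filterdiff_comp (U := R_NormedModule) (V := C_R_NormedModule)
           (W := R_NormedModule) phi fst _ fst H).
  apply filterdiff_linear. apply (@is_linear_fst R_AbsRing R_NormedModule R_NormedModule).
Qed.

(** Reduces a complex integral to real ones: [c = 1] gives its real part and
    [c = - i] its imaginary part. *)
Lemma Re_Cmult_RInt (c : C) (g : R -> C) :
  (forall s, 0 <= s <= 1 -> continuous_to_C g s) ->
  is_RInt (fun s => fst (c * g s)%C) 0 1
    (fst (c * RInt (V := C_R_CompleteNormedModule) g 0 1)%C).
Proof.
  intros Hg.
  assert (Hex : @ex_RInt C_R_NormedModule g 0 1).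
  { apply (ex_RInt_continuous (V := C_R_CompleteNormedModule)).
    rewrite Rmin_left, Rmax_right by lra. exact Hg. }
  pose proof (RInt_correct (V := C_R_CompleteNormedModule) g 0 1 Hex) as HI.
  set (I := RInt (V := C_R_CompleteNormedModule) g 0 1) in *. clearbody I.
  pose proof (@is_RInt_fct_extend_fst R_NormedModule R_NormedModule g 0 1 I HI) as H1.
  pose proof (@is_RInt_fct_extend_snd R_NormedModule R_NormedModule g 0 1 I HI) as H2.
  exact (is_RInt_minus _ _ 0 1 _ _
           (is_RInt_scal _ 0 1 (fst c) _ H1) (is_RInt_scal _ 0 1 (snd c) _ H2)).
Qed.

(** * Primitives and logarithms on star-shaped open sets *)

Definition open_star (U : C -> Prop) : Prop :=
  (forall z, U z -> @locally C_UniformSpace z U) /\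
  (forall z, U z -> forall s : R, 0 <= s <= 1 -> U (RtoC s * z)%C).

(** Differentiation under the integral sign replaces Cauchy's theorem here.  Along
    the line [w = z + u v], the integrand [w p (s w)] has the [u]-derivative
    [v (p (s w) + s w p' (s w))], which is also the [s]-derivative of
    [v s p (s w)]; integrated over [0 <= s <= 1] it gives [v p w].  The factor [c]
    selects the real or the imaginary part, since the theorem on parametric
    integrals is one about real functions. *)
Lemma is_derive_segment_integral (U : C -> Prop) (p dp : C -> C) (c z v : C)
    (x : R) :
  open_star U ->
  (forall w, U w -> is_Cderive p w (dp w)) ->
  (forall w, U w -> C_continuous dp w) ->
  U (z + RtoC x * v)%C ->
  is_derive (fun u => fst (c * segment_integral p (z + RtoC u * v))%C) x
    (fst (c * (v * p (z + RtoC x * v)))%C).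
Proof.
  intros [Hopen Hstar] Hp Hdp Hx.
  assert (Hline : forall y : R,
    @continuous R_UniformSpace C_UniformSpace (fun u => z + RtoC u * v)%C y).
  { intros y. apply (continuous_Cplus (fun _ => z)); [apply continuous_const|].
    apply continuous_ray. }
  assert (HU : locally x (fun u => U (z + RtoC u * v)%C)).
  { apply (Hline x). apply Hopen, Hx. }
  set (F := fun u s : R => fst (c * (z + RtoC u * v)
                               * p (RtoC s * (z + RtoC u * v)))%C).
  set (dF := fun (u s : R) => fst (c * v * (p (RtoC s * (z + RtoC u * v))
       + RtoC s * (z + RtoC u * v) * dp (RtoC s * (z + RtoC u * v))))%C).
  assert (Hps : forall w s, U (RtoC s * w)%C ->
    @continuous R_UniformSpace C_UniformSpace (fun y => p (RtoC y * w)%C) s).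
  { intros w s Hw.
    apply (continuous_comp (U := R_UniformSpace) (V := C_UniformSpace)
             (fun y : R => RtoC y * w)%C p).
    - apply continuous_ray.
    - apply (is_Cderive_continuous p _ (dp (RtoC s * w)%C)). apply Hp, Hw. }
  assert (HF : forall u s, U (RtoC s * (z + RtoC u * v))%C ->
            is_derive (fun u' => F u' s) u (dF u s)).
  { intros u s Hus. unfold F, dF.
    apply (is_derive_Re (fun u' => c * (z + RtoC u' * v)
                               * p (RtoC s * (z + RtoC u' * v)))%C).
    set (w := (z + RtoC u * v)%C).
    replace (c * v * (p (RtoC s * w) + RtoC s * w * dp (RtoC s * w)))%C
      with (v * (c * RtoC 1 * p (RtoC s * w)
                 + c * w * (RtoC s * RtoC 1 * dp (RtoC s * w))))%C by ring.
    apply (is_derive_along (fun w => c * w * p (RtoC s * w))%C). fold w.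
    apply (is_Cderive_mult (fun w => c * w)%C (fun w => p (RtoC s * w)%C)).
    - apply is_Cderive_scal, is_Cderive_id.
    - apply (is_Cderive_comp p (fun w => RtoC s * w)%C); [apply Hp, Hus|].
      apply is_Cderive_scal, is_Cderive_id. }
  apply (is_derive_ext_loc (V := R_NormedModule) (fun u => RInt (F u) 0 1)).
  { revert HU. apply filter_imp. intros u Hu. unfold F, segment_integral.
    rewrite Cmult_assoc. apply is_RInt_unique, Re_Cmult_RInt.
    intros s Hs. apply Hps, Hstar; assumption. }
  replace (fst (c * (v * p (z + RtoC x * v)))%C)
    with (RInt (fun s => Derive (fun u => F u s) x) 0 1).
  - apply is_derive_RInt_param.
    + revert HU. apply filter_imp. intros u Hu s Hs.
      rewrite Rmin_left, Rmax_right in Hs by lra.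
      exists (dF u s). apply HF, Hstar; assumption.
    + intros s Hs. rewrite Rmin_left, Rmax_right in Hs by lra.
      assert (Hxs : U (RtoC s * (z + RtoC x * v))%C) by (apply Hstar; assumption).
      assert (Hl : forall y, @continuous (prod_UniformSpace R_UniformSpace R_UniformSpace)
          C_UniformSpace (fun q => z + RtoC (fst q) * v)%C y).
      { intros y. apply (continuous_comp (V := R_UniformSpace) fst
           (fun u => z + RtoC u * v)%C); [|apply Hline].
        destruct y; apply continuous_fst. }
      assert (Hr : forall y, @continuous (prod_UniformSpace R_UniformSpace R_UniformSpace)
          C_UniformSpace (fun q => RtoC (snd q)) y).
      { intros y. apply continuous_RtoC. destruct y; apply continuous_snd. }
      assert (Hm : forall y, @continuous (prod_UniformSpace R_UniformSpace R_UniformSpace)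
          C_UniformSpace (fun q => RtoC (snd q) * (z + RtoC (fst q) * v))%C y).
      { intros y. apply (continuous_Cmult (fun q => RtoC (snd q))); auto. }
      apply (continuity_2d_pt_ext_loc dF).
      * apply locally_2d_locally.
        assert (H : locally (x, s)
          (fun q : R * R => U (RtoC (snd q) * (z + RtoC (fst q) * v))%C))
          by exact (Hm (x, s) _ (Hopen _ Hxs)).
        revert H.
        apply filter_imp. intros [u s'] H. simpl in *.
        symmetry. apply is_derive_unique, HF, H.
      * apply continuity_2d_pt_filterlim.
        change (@continuous (prod_UniformSpace R_UniformSpace R_UniformSpace)
                  R_UniformSpace (fun q => dF (fst q) (snd q)) (x, s)).
        unfold dF. apply (continuous_Re (fun q : R * R => c * v *
          (p (RtoC (snd q) * (z + RtoC (fst q) * v)) +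
           RtoC (snd q) * (z + RtoC (fst q) * v) *
           dp (RtoC (snd q) * (z + RtoC (fst q) * v))))%C).
        apply (continuous_Cmult (fun _ => (c * v)%C)); [apply continuous_const|].
        apply (continuous_Cplus (fun q : R * R => p (RtoC (snd q) * (z + RtoC (fst q) * v))%C)).
        -- apply (continuous_comp (U := prod_UniformSpace R_UniformSpace R_UniformSpace)
             (V := C_UniformSpace)
             (fun q : R * R => RtoC (snd q) * (z + RtoC (fst q) * v))%C p); [apply Hm|].
           apply (is_Cderive_continuous p _ _ (Hp _ Hxs)).
        -- apply (continuous_Cmult (fun q : R * R => RtoC (snd q) * (z + RtoC (fst q) * v))%C);
             [apply Hm|].
           apply (continuous_comp (U := prod_UniformSpace R_UniformSpace R_UniformSpace)
             (V := C_UniformSpace)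
             (fun q : R * R => RtoC (snd q) * (z + RtoC (fst q) * v))%C dp); [apply Hm|].
           apply Hdp, Hxs.
    + revert HU. apply filter_imp. intros u Hu.
      apply (ex_RInt_continuous (V := R_CompleteNormedModule)).
      intros s Hs. rewrite Rmin_left, Rmax_right in Hs by lra.
      unfold F. apply (continuous_Re (fun s => c * (z + RtoC u * v)
                               * p (RtoC s * (z + RtoC u * v)))%C).
      apply (continuous_Cmult (fun _ => (c * (z + RtoC u * v))%C));
        [apply continuous_const|].
      apply Hps, Hstar; assumption.
  - rewrite (RInt_ext _ (fun s => dF x s)).
    2:{ intros s Hs. rewrite Rmin_left, Rmax_right in Hs by lra.
        apply is_derive_unique, HF, Hstar; [assumption|lra]. }
    set (w := (z + RtoC x * v)%C) in *.
    apply is_RInt_unique.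
    replace (fst (c * (v * p w))%C)
      with (minus (fst (RtoC 1 * (c * v * p (RtoC 1 * w)))%C)
                  (fst (RtoC 0 * (c * v * p (RtoC 0 * w)))%C)).
    2:{ unfold minus, plus, opp; simpl.
        replace (RtoC 1 * w)%C with w by ring.
        replace (c * (v * p w))%C with (c * v * p w)%C by ring. ring. }
    apply (is_RInt_derive (V := R_CompleteNormedModule)
             (fun s => fst (RtoC s * (c * v * p (RtoC s * w)))%C)).
    + intros s Hs. rewrite Rmin_left, Rmax_right in Hs by lra.
      apply (is_derive_Re (fun s => RtoC s * (c * v * p (RtoC s * w)))%C).
      apply (is_derive_ext (V := C_R_NormedModule)
        (fun s => (fun y => y * (c * v * p (y * w))) (RtoC 0 + RtoC s * RtoC 1))%C).
      { intros y. simpl. replace (RtoC 0 + RtoC y * RtoC 1)%C with (RtoC y) by ring.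
        reflexivity. }
      unfold dF. fold w.
      replace (c * v * (p (RtoC s * w) + RtoC s * w * dp (RtoC s * w)))%C
        with (RtoC 1 * (RtoC 1 * (c * v * p (RtoC s * w))
           + RtoC s * (c * v * (RtoC 1 * w + RtoC s * RtoC 0) * dp (RtoC s * w))))%C by ring.
      apply (is_derive_along (fun y => y * (c * v * p (y * w)))%C).
      replace (RtoC 0 + RtoC s * RtoC 1)%C with (RtoC s) by ring.
      apply (is_Cderive_mult (fun y => y) (fun y => c * v * p (y * w))%C);
        [apply is_Cderive_id|].
      rewrite <- (Cmult_assoc (c * v)%C).
      apply (is_Cderive_scal (c * v)%C (fun y => p (y * w)%C)).
      apply (is_Cderive_comp p (fun y => y * w)%C); [apply Hp, Hstar; assumption|].
      apply (is_Cderive_mult (fun y => y) (fun _ => w));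
        [apply is_Cderive_id|apply is_Cderive_const].
    + intros s Hs. rewrite Rmin_left, Rmax_right in Hs by lra.
      unfold dF. fold w.
      apply (continuous_Re (fun s : R => c * v *
          (p (RtoC s * w) + RtoC s * w * dp (RtoC s * w)))%C).
      assert (Hsw : U (RtoC s * w)%C) by (apply Hstar; assumption).
      assert (Hm : @continuous R_UniformSpace C_UniformSpace (fun y => RtoC y * w)%C s).
      { apply continuous_ray. }
      apply (continuous_Cmult (fun _ => (c * v)%C)); [apply continuous_const|].
      apply (continuous_Cplus (fun y => p (RtoC y * w)%C)); [apply Hps, Hsw|].
      apply (continuous_Cmult (fun y => RtoC y * w)%C); [exact Hm|].
      apply (continuous_comp (U := R_UniformSpace) (V := C_UniformSpace)
               (fun y : R => RtoC y * w)%C dp); [exact Hm|apply Hdp, Hsw].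
Qed.

(** Near [z], the derivative of [F w - F z - (w - z) p z] along the segment from
    [z] to [w] is [(w - z) (p - p z)], which continuity of [p] makes at most
    [eps / 2] times [|w - z|]; the mean value inequality, once for the real part
    and once for the imaginary part, does the rest. *)
Lemma segment_integral_primitive (U : C -> Prop) (p dp : C -> C) :
  open_star U ->
  (forall w, U w -> is_Cderive p w (dp w)) ->
  (forall w, U w -> C_continuous dp w) ->
  forall z, U z -> is_Cderive (segment_integral p) z (p z).
Proof.
  intros HU Hp Hdp z Hz. apply is_Cderive_Cmod. intros eps Heps.
  destruct (proj1 (locally_Cmod z U) (proj1 HU z Hz)) as [d1 [Hd1 H1]].
  assert (Hc : @locally C_UniformSpace z (fun w => Cmod (p w - p z) < eps / 2)).
  { apply (is_Cderive_continuous p z _ (Hp z Hz)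
             (fun y => Cmod (y - p z) < eps / 2)).
    apply locally_Cmod. exists (eps / 2). split; [lra|auto]. }
  apply locally_Cmod in Hc. destruct Hc as [d2 [Hd2 H2]].
  exists (Rmin d1 d2). split; [apply Rmin_pos; assumption|].
  intros w Hw. set (v := (w - z)%C) in *.
  (* The bound [|t| <= 1] instead of [0 <= t <= 1] is the form in which
     [bounded_variation] asks for the derivative. *)
  assert (Hv : forall t : R, Rabs t <= 1 ->
            U (z + RtoC t * v)%C /\ Cmod (p (z + RtoC t * v)%C - p z) < eps / 2).
  { intros t Ht.
    assert (Hd : Cmod (z + RtoC t * v - z) <= Cmod v).
    { replace (z + RtoC t * v - z)%C with (RtoC t * v)%C by ring.
      rewrite Cmod_mult, Cmod_R. pose proof (Cmod_ge_0 v). nra. }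
    pose proof (Rmin_l d1 d2). pose proof (Rmin_r d1 d2).
    split; [apply H1|apply H2]; lra. }
  set (F := segment_integral p).
  assert (Hre : forall c : C, Cmod c = 1 ->
            Rabs (fst (c * (F w - F z - v * p z))%C) <= eps / 2 * Cmod v).
  { intros c Hc.
    pose (h := fun t : R => fst (c * F (z + RtoC t * v))%C - fst (c * (v * p z))%C * t).
    pose (dh := fun t : R => fst (c * (v * p (z + RtoC t * v)))%C - fst (c * (v * p z))%C * 1).
    replace (fst (c * (F w - F z - v * p z))%C) with (h 1 - h 0).
    2:{ unfold h. replace (z + RtoC 1 * v)%C with w by (unfold v; ring).
        replace (z + RtoC 0 * v)%C with z by ring.
        generalize (F w), (F z), (v * p z)%C. intros a b e.
        unfold Cmult, Cminus, Cplus, Copp; simpl. ring. }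
    replace (eps / 2 * Cmod v) with (eps / 2 * Cmod v * Rabs (1 - 0))
      by (rewrite Rminus_0_r, Rabs_R1; ring).
    apply (bounded_variation h dh). intros t Ht.
    rewrite !Rminus_0_r, Rabs_R1 in Ht. destruct (Hv t Ht) as [Hu Hb]. split.
    - apply (is_derive_minus (V := R_NormedModule)
               (fun t => fst (c * F (z + RtoC t * v))%C)).
      + apply (is_derive_segment_integral U p dp); assumption.
      + apply (is_derive_scal (fun t => t)), (@is_derive_id R_AbsRing).
    - replace (dh t) with (Re (c * (v * (p (z + RtoC t * v) - p z)))%C).
      + eapply Rle_trans; [apply re_le_Cmod|].
        rewrite !Cmod_mult, Hc, Rmult_1_l, Rmult_comm.
        apply Rmult_le_compat_r; [apply Cmod_ge_0|lra].
      + unfold dh. generalize (p (z + RtoC t * v)%C), (p z). intros a b.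
        unfold Re, Cmult, Cminus, Cplus, Copp; simpl. ring. }
  pose proof (Hre (RtoC 1) Cmod_1) as HR.
  assert (Hi : Cmod (- Ci) = 1).
  { unfold Cmod, Ci, Copp; simpl. replace (_ + _) with 1 by ring. apply sqrt_1. }
  pose proof (Hre (- Ci)%C Hi) as HI.
  eapply Rle_trans; [apply Cmod_le_parts|]. fold v.
  rewrite Cmult_1_l in HR.
  replace (fst (- Ci * (F w - F z - v * p z))%C) with (snd (F w - F z - v * p z)%C) in HI
    by (generalize (F w - F z - v * p z)%C; intros a;
        unfold Ci, Cmult, Copp; simpl; ring).
  lra.
Qed.

Lemma open_star_0 (U : C -> Prop) (z : C) : open_star U -> U z -> U (RtoC 0).
Proof.
  intros [_ H] Hz. replace (RtoC 0) with (RtoC 0 * z)%C by ring.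
  apply H; [exact Hz|lra].
Qed.

Lemma is_Cderive_0_eq (U : C -> Prop) (f : C -> C) :
  open_star U -> (forall w, U w -> is_Cderive f w (RtoC 0)) ->
  forall z, U z -> f z = f (RtoC 0).
Proof.
  intros HU Hf z Hz.
  pose (h := fun s : R => f (RtoC 0 + RtoC s * z)%C).
  assert (E : h 0 = h 1).
  { apply (eq_is_derive (V := C_R_NormedModule)); [|lra].
    intros s Hs. unfold h.
    replace (@zero C_R_NormedModule) with (z * RtoC 0)%C by apply Cmult_0_r.
    apply is_derive_along, Hf.
    replace (RtoC 0 + RtoC s * z)%C with (RtoC s * z)%C by ring.
    apply HU; assumption. }
  unfold h in E.
  replace (RtoC 0 + RtoC 0 * z)%C with (RtoC 0) in E by ring.
  replace (RtoC 0 + RtoC 1 * z)%C with z in E by ring. auto.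
Qed.

Lemma segment_integral_0 (p : C -> C) : segment_integral p (RtoC 0) = RtoC 0.
Proof. unfold segment_integral. apply Cmult_0_l. Qed.

(** The product [g exp (- L)] has derivative [0], so it keeps its value [1] at
    [0]. *)
Lemma segment_integral_log (U : C -> Prop) (g dg ddg : C -> C) :
  open_star U ->
  (forall w, U w -> is_Cderive g w (dg w)) ->
  (forall w, U w -> is_Cderive dg w (ddg w)) ->
  (forall w, U w -> C_continuous ddg w) ->
  (forall w, U w -> g w <> RtoC 0) ->
  g (RtoC 0) = RtoC 1 ->
  let L := segment_integral (fun w => dg w / g w)%C in
  forall z, U z -> is_Cderive L z (dg z / g z)%C /\ Cexp (L z) = g z.
Proof.
  intros HU Hg Hdg Hddg Hnz H0 L.
  assert (HL : forall z, U z -> is_Cderive L z (dg z / g z)%C).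
  { apply (segment_integral_primitive U _
            (fun w => (ddg w * g w - dg w * dg w) / (g w) ^ 2)%C HU).
    - intros w Hw. apply is_Cderive_div; auto.
    - intros w Hw.
      assert (Cg : C_continuous g w)
        by (apply (is_Cderive_continuous _ _ _ (Hg w Hw))).
      assert (Cdg : C_continuous dg w)
        by (apply (is_Cderive_continuous _ _ _ (Hdg w Hw))).
      apply (continuous_Cmult (T := C_UniformSpace)
               (fun w => ddg w * g w - dg w * dg w)%C (fun w => / (g w) ^ 2)%C).
      + apply (continuous_Cplus (T := C_UniformSpace)
                 (fun w => ddg w * g w)%C (fun w => - (dg w * dg w))%C).
        * apply (continuous_Cmult (T := C_UniformSpace)); auto.
        * apply (continuous_opp (K := C_AbsRing) (V := C_NormedModule)
                   (fun w => dg w * dg w)%C).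
          apply (continuous_Cmult (T := C_UniformSpace)); assumption.
      + apply (continuous_comp (U := C_UniformSpace) (V := C_UniformSpace)
                 (fun w => g w ^ 2)%C Cinv).
        * apply (continuous_Cmult (T := C_UniformSpace) g (fun w => g w * 1)%C);
            [assumption|].
          apply (continuous_Cmult (T := C_UniformSpace) g (fun _ => RtoC 1));
            [assumption|apply continuous_const].
        * eapply is_Cderive_continuous, is_Cderive_inv.
          apply Cpow_nz; auto. }
  intros z Hz. split; [auto|].
  pose (h := fun w => (g w * Cexp (RtoC (-1) * L w))%C).
  assert (E : h z = h (RtoC 0)).
  { apply (is_Cderive_0_eq U h HU); [|exact Hz]. intros w Hw. unfold h.
    replace (RtoC 0) with (dg w * Cexp (RtoC (-1) * L w)
      + g w * (RtoC (-1) * (dg w / g w) * Cexp (RtoC (-1) * L w)))%C.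
    - apply (is_Cderive_mult g (fun w => Cexp (RtoC (-1) * L w))%C); [auto|].
      apply (is_Cderive_Cexp_comp (fun w => RtoC (-1) * L w)%C).
      apply is_Cderive_scal; auto.
    - field. auto. }
  unfold h in E. unfold L at 2 in E.
  rewrite segment_integral_0, H0, Cmult_0_r, Cexp_0, Cmult_1_l in E.
  rewrite <- (Cmult_1_l (Cexp (L z))), <- E, <- Cmult_assoc, <- Cexp_plus.
  replace (RtoC (-1) * L z + L z)%C with (RtoC 0) by ring.
  rewrite Cexp_0. ring.
Qed.

(** The nonzero solutions [2 pi i k] of [exp z = 1] are far from [0]. *)
Lemma Cexp_1_near_0 (z : C) : Cexp z = RtoC 1 -> Cmod z < 1 -> z = RtoC 0.
Proof.
  intros H Hm. pose proof (Rmax_Cmod z) as HM.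
  pose proof (Rmax_r (Rabs (fst z)) (Rabs (snd z))).
  destruct z as [x y]. simpl in *. unfold Cexp, RtoC, Re, Im in H; simpl in H.
  injection H as H1 H2. pose proof (exp_pos x).
  assert (Hs : sin y = 0) by nra.
  assert (Hy : y = 0).
  { destruct (Rabs_def2 y 1) as [Hy1 Hy2]; [lra|]. pose proof PI2_1.
    destruct (Rtotal_order y 0) as [Hn | [E | Hp]]; [|exact E|].
    - assert (0 < sin (- y)) by (apply sin_gt_0; lra).
      rewrite sin_neg in *. lra.
    - assert (0 < sin y) by (apply sin_gt_0; lra). lra. }
  subst y. rewrite cos_0, Rmult_1_r, <- exp_0 in H1. apply exp_inv in H1.
  subst x. reflexivity.
Qed.

(** By [Cexp_1_near_0] such a function is locally constant; hence it is
    holomorphic with derivative [0], and constant on the star-shaped set. *)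
Lemma continuous_log_of_1 (U : C -> Prop) (D : C -> C) :
  open_star U ->
  (forall w, U w -> C_continuous D w) ->
  (forall w, U w -> Cexp (D w) = RtoC 1) ->
  forall z, U z -> D z = D (RtoC 0).
Proof.
  intros HU HD H1. apply (is_Cderive_0_eq U D HU). intros w Hw.
  apply (is_Cderive_ext_loc (fun _ => D w)); [|apply is_Cderive_const].
  assert (Hn : @locally C_UniformSpace w (fun w' => Cmod (D w' - D w) < 1)).
  { apply (HD w Hw (fun y => Cmod (y - D w) < 1)). apply locally_Cmod. exists 1. split; [lra|auto]. }
  generalize (filter_and _ _ Hn (proj1 HU w Hw)). apply filter_imp.
  intros w' [Hm Hw']. symmetry.
  assert (E : (D w' - D w)%C = RtoC 0).
  { apply Cexp_1_near_0; [|exact Hm].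
    rewrite <- (Cmult_1_r (Cexp _)), <- (H1 w Hw), <- Cexp_plus.
    replace (D w' - D w + D w)%C with (D w') by ring.
    rewrite (H1 w Hw). auto. }
  replace (D w') with (D w' - D w + D w)%C by ring. rewrite E. ring.
Qed.

(** Any logarithm [L'] that the definition may have chosen is [L + L' 0], so the two
    branches differ by the factor [exp (alpha L' 0)], which is the value of the
    chosen branch at [0], that is [1]. *)
Lemma power_branch_eq (U : C -> Prop) (g L : C -> C) (alpha : R) :
  open_star U ->
  (forall w, U w -> C_continuous L w) ->
  (forall w, U w -> Cexp (L w) = g w) ->
  L (RtoC 0) = RtoC 0 ->
  forall z, U z -> power_branch U g alpha z = Cexp (RtoC alpha * L z)%C.
Proof.
  intros HU HL Hg HL0.
  assert (Hex : is_power_branch U g alpha (fun z => Cexp (RtoC alpha * L z)%C)).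
  { split.
    - exists L. split; [|split; auto].
      intros w Hw. apply filterlim_filter_le_1 with (2 := HL w Hw).
      apply filter_le_within.
    - rewrite HL0, Cmult_0_r. apply Cexp_0. }
  assert (Hpb : is_power_branch U g alpha (power_branch U g alpha)).
  { exact (epsilon_spec _ (is_power_branch U g alpha) (ex_intro _ _ Hex)). }
  destruct Hpb as [[L' [HL' [Hg' Hpow]]] H1]. intros z Hz.
  assert (E : (L' z - L z)%C = (L' (RtoC 0) - L (RtoC 0))%C).
  { apply (continuous_log_of_1 U (fun w => L' w - L w)%C HU); [| |exact Hz].
    - intros w Hw.
      apply (continuous_minus (K := C_AbsRing) (V := C_NormedModule) L' L);
        [|apply HL, Hw].
      intros P HP.
      generalize (filter_and (F := @locally C_UniformSpace w) _ _
                    (HL' w Hw P HP) (proj1 HU w Hw)).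
      apply (filter_imp (F := @locally C_UniformSpace w)).
      intros w' [A B]. apply A, B.
    - intros w Hw. unfold Cminus.
      rewrite Cexp_plus, Hg', <- Hg, <- Cexp_plus, Cplus_opp_r by exact Hw.
      apply Cexp_0. }
  rewrite HL0 in E. rewrite Hpow by exact Hz.
  replace (L' z) with (L z + L' (RtoC 0))%C.
  - rewrite Cmult_plus_distr_l, Cexp_plus, <- (Hpow (RtoC 0)), H1; [ring|].
    exact (open_star_0 U z HU Hz).
  - replace (L' z) with (L' z - L z + L z)%C by ring. rewrite E. ring.
Qed.

(** * The quartic *)

Definition quartic' (t : R) (z : C) : C :=
  (4 * z ^ 3 - 4 * RtoC (cos (2 * t)) * z)%C.

Definition quartic'' (t : R) (z : C) : C :=
  (12 * z ^ 2 - 4 * RtoC (cos (2 * t)))%C.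

Lemma is_Cderive_pow (n : nat) (z : C) :
  is_Cderive (fun w => w ^ S n)%C z (RtoC (INR (S n)) * z ^ n)%C.
Proof.
  induction n as [|n IH].
  - apply (is_Cderive_ext (fun w => w)).
    + intros w. simpl. ring.
    + replace (RtoC (INR 1) * z ^ 0)%C with (RtoC 1) by (simpl; ring).
      apply is_Cderive_id.
  - replace (RtoC (INR (S (S n))) * z ^ S n)%C
      with (RtoC 1 * z ^ S n + z * (RtoC (INR (S n)) * z ^ n))%C.
    + exact (is_Cderive_mult (fun w => w) (fun w => w ^ S n)%C z _ _
               (is_Cderive_id z) IH).
    + rewrite (S_INR (S n)), RtoC_plus. simpl. ring.
Qed.

Lemma is_Cderive_quartic (t : R) (z : C) :
  is_Cderive (quartic t) z (quartic' t z).
Proof.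
  unfold quartic, quartic'. set (c := RtoC (cos (2 * t))).
  apply (is_Cderive_ext (fun w => RtoC 1 + (- (2 * c) * w ^ 2 + w ^ 4))%C).
  { intros w. simpl. ring. }
  replace (4 * z ^ 3 - 4 * c * z)%C
    with (RtoC 0 + (- (2 * c) * (RtoC (INR 2) * z ^ 1) + RtoC (INR 4) * z ^ 3))%C.
  - apply (is_Cderive_plus (fun _ => RtoC 1)); [apply is_Cderive_const|].
    apply (is_Cderive_plus (fun w => - (2 * c) * w ^ 2)%C (fun w => w ^ 4)%C).
    + apply (is_Cderive_scal (- (2 * c))%C (fun w => w ^ 2)%C), is_Cderive_pow.
    + apply is_Cderive_pow.
  - rewrite !INR_IZR_INZ. simpl.
    ring.
Qed.

Lemma is_Cderive_quartic' (t : R) (z : C) :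
  is_Cderive (quartic' t) z (quartic'' t z).
Proof.
  unfold quartic', quartic''. set (c := RtoC (cos (2 * t))).
  apply (is_Cderive_ext (fun w => 4 * w ^ 3 + - (4 * c) * w)%C).
  { intros w. simpl. ring. }
  replace (12 * z ^ 2 - 4 * c)%C
    with (4 * (RtoC (INR 3) * z ^ 2) + - (4 * c) * RtoC 1)%C.
  - apply (is_Cderive_plus (fun w => 4 * w ^ 3)%C (fun w => - (4 * c) * w)%C).
    + apply (is_Cderive_scal 4 (fun w => w ^ 3)%C), is_Cderive_pow.
    + apply is_Cderive_scal, is_Cderive_id.
  - rewrite !INR_IZR_INZ. simpl.
    ring.
Qed.

Lemma continuous_quartic'' (t : R) (z : C) :
  C_continuous (quartic'' t) z.
Proof.
  apply (is_Cderive_continuous _ _ (12 * (RtoC (INR 2) * z ^ 1))%C).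
  unfold quartic''.
  replace (12 * (RtoC (INR 2) * z ^ 1))%C
    with (12 * (RtoC (INR 2) * z ^ 1) + RtoC 0)%C by ring.
  apply (is_Cderive_plus (fun w => 12 * w ^ 2)%C (fun _ => - (4 * _))%C).
  - apply (is_Cderive_scal 12 (fun w => w ^ 2)%C), is_Cderive_pow.
  - apply is_Cderive_const.
Qed.

Lemma unit_a_eq (t : R) : unit_a t = (cos t, sin t).
Proof.
  unfold unit_a, Cexp. simpl.
  replace (0 * t - 1 * 0) with 0 by ring. replace (0 * 0 + 1 * t) with t by ring.
  rewrite exp_0, !Rmult_1_l. reflexivity.
Qed.

Lemma unit_a_sq (t : R) :
  (unit_a t ^ 2 = RtoC (cos (2 * t)) + Ci * RtoC (sin (2 * t)))%C.
Proof.
  rewrite unit_a_eq, cos_2a, sin_2a. apply injective_projections; simpl; ring.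
Qed.

Lemma unit_a_conj_sq (t : R) :
  (Cconj (unit_a t) ^ 2 = RtoC (cos (2 * t)) - Ci * RtoC (sin (2 * t)))%C.
Proof.
  rewrite unit_a_eq, cos_2a, sin_2a. apply injective_projections; simpl; ring.
Qed.

Lemma Ci_sq : (Ci * Ci = - RtoC 1)%C.
Proof. unfold Ci, Cmult, Copp, RtoC; simpl. f_equal; ring. Qed.

Lemma unit_a_sum (t : R) :
  (unit_a t ^ 2 + Cconj (unit_a t) ^ 2 = 2 * RtoC (cos (2 * t)))%C.
Proof. rewrite unit_a_sq, unit_a_conj_sq. ring. Qed.

Lemma unit_a_diff (t : R) :
  (unit_a t ^ 2 - Cconj (unit_a t) ^ 2 = 2 * Ci * RtoC (sin (2 * t)))%C.
Proof. rewrite unit_a_sq, unit_a_conj_sq. ring. Qed.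

Lemma unit_a_prod (t : R) : (unit_a t ^ 2 * Cconj (unit_a t) ^ 2 = 1)%C.
Proof.
  rewrite unit_a_sq, unit_a_conj_sq.
  pose proof (sin2_cos2 (2 * t)) as H. unfold Rsqr in H.
  apply injective_projections; simpl; [nra|ring].
Qed.

Lemma quartic_factor (t : R) (z : C) :
  quartic t z = ((z ^ 2 - unit_a t ^ 2) * (z ^ 2 - Cconj (unit_a t) ^ 2))%C.
Proof.
  pose proof (unit_a_prod t) as P. unfold quartic. rewrite <- unit_a_sum.
  set (A := (unit_a t ^ 2)%C) in *. set (B := (Cconj (unit_a t) ^ 2)%C) in *.
  replace ((z ^ 2 - A) * (z ^ 2 - B))%C
    with (A * B - (A + B) * z ^ 2 + z ^ 4)%C by (simpl; ring).
  rewrite P. reflexivity.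
Qed.

Lemma quartic_factor_neq_0 (t : R) (z : C) : quartic t z <> RtoC 0 ->
  (z ^ 2 - unit_a t ^ 2 <> 0)%C /\ (z ^ 2 - Cconj (unit_a t) ^ 2 <> 0)%C.
Proof.
  rewrite quartic_factor. intros H.
  split; intros E; apply H; rewrite E; ring.
Qed.

(** The numerator over the common denominator is
    [A (x - B) ^ 2 + B (x - A) ^ 2 = (A + B) x ^ 2 - 4 A B x + A B (A + B)], with
    [x = z ^ 2], [A = a ^ 2] and [B] the conjugate of [A]. *)
Lemma psi0_quartic (t : R) (z : C) : quartic t z <> RtoC 0 ->
  psi0 t z = (3 / 4 * (2 * RtoC (cos (2 * t)) * z ^ 4 - 4 * z ^ 2
                       + 2 * RtoC (cos (2 * t))) / quartic t z ^ 2)%C.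
Proof.
  intros H. destruct (quartic_factor_neq_0 t z H) as [HA HB].
  rewrite quartic_factor. unfold psi0.
  pose proof (unit_a_prod t) as P. rewrite <- unit_a_sum.
  set (A := (unit_a t ^ 2)%C) in *. set (B := (Cconj (unit_a t) ^ 2)%C) in *.
  clearbody A B.
  (* Homogenizing with [A * B = 1] makes the equation one of rational functions
     in independent [A], [B], [z]. *)
  replace ((A + B) * z ^ 4 - 4 * z ^ 2 + (A + B))%C
    with ((A + B) * z ^ 4 - 4 * (A * B) * z ^ 2 + (A * B) * (A + B))%C
    by (rewrite P; ring).
  field. repeat split; assumption.
Qed.

Lemma psi1_quartic (t : R) (z : C) : quartic t z <> RtoC 0 ->
  psi1 t z = (2 * RtoC (sin (2 * t)) / quartic t z)%C.
Proof.
  intros H. destruct (quartic_factor_neq_0 t z H) as [HA HB].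
  rewrite quartic_factor. unfold psi1.
  replace (2 * RtoC (sin (2 * t)))%C with (- Ci * (unit_a t ^ 2 - Cconj (unit_a t) ^ 2))%C.
  - set (A := (unit_a t ^ 2)%C) in *. set (B := (Cconj (unit_a t) ^ 2)%C) in *.
    clearbody A B. field. split; assumption.
  - rewrite unit_a_diff.
    replace (- Ci * (2 * Ci * RtoC (sin (2 * t))))%C
      with (- (Ci * Ci) * (2 * RtoC (sin (2 * t))))%C by ring.
    rewrite Ci_sq. ring.
Qed.

(** A sum of squares, which makes the quartic positive on the real line as soon as
    [sin 2t] is not [0]. *)
Lemma quartic_RtoC (t s : R) :
  quartic t (RtoC s) = RtoC ((s ^ 2 - cos (2 * t)) ^ 2 + sin (2 * t) ^ 2).
Proof.
  pose proof (sin2_cos2 (2 * t)) as H. unfold Rsqr in H.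
  replace (sin (2 * t) ^ 2) with (1 - cos (2 * t) * cos (2 * t)) by (simpl; lra).
  apply injective_projections; simpl; ring.
Qed.

(** From the factor [w - z] in [(w + z) (w ^ 2 + z ^ 2 - 2 cos 2t) (w - z)]. *)
Lemma quartic_bound (t M : R) (z w : C) : Cmod z <= M -> Cmod w <= M ->
  Cmod (quartic t w - quartic t z) <= (2 * M * (2 * M ^ 2 + 2)) * Cmod (w - z).
Proof.
  intros Hz Hw. pose proof (Cmod_ge_0 z). pose proof (Cmod_ge_0 w).
  set (c := RtoC (cos (2 * t))).
  replace (quartic t w - quartic t z)%C
    with ((w + z) * ((w * w + z * z) + - (2 * c)) * (w - z))%C
    by (unfold quartic; fold c; simpl; ring).
  rewrite !Cmod_mult. apply Rmult_le_compat_r; [apply Cmod_ge_0|].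
  apply Rmult_le_compat; try apply Cmod_ge_0.
  - eapply Rle_trans; [apply Cmod_triangle|lra].
  - eapply Rle_trans; [apply Cmod_triangle|]. apply Rplus_le_compat.
    + eapply Rle_trans; [apply Cmod_triangle|]. rewrite !Cmod_mult. simpl. nra.
    + rewrite Cmod_opp, Cmod_mult. unfold c. rewrite !Cmod_R.
      rewrite (Rabs_pos_eq 2) by lra.
      assert (Rabs (cos (2 * t)) <= 1) by (apply Rabs_le, COS_bound). lra.
Qed.

(** Openness is a compactness argument: on the segment from [0] to [z] the modulus
    of the quartic has a positive minimum [m], and by [quartic_bound] moving [z] by
    less than [min (1, m / K)] changes the quartic by less than [m] along the whole
    segment. *)
Lemma open_star_star_domain (t : R) : open_star (star_domain t).
Proof.
  split.
  - intros z Hz.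
    assert (Hcont : forall s : R,
      continuous (fun s : R => Cmod (quartic t (RtoC s * z)%C)) s).
    { intros s.
      apply (continuous_comp (U := R_UniformSpace) (V := C_UniformSpace)
               (fun s : R => quartic t (RtoC s * z)%C) Cmod).
      - apply (continuous_comp (U := R_UniformSpace) (V := C_UniformSpace)
                 (fun s : R => RtoC s * z)%C (quartic t)).
        + apply continuous_ray.
        + apply (is_Cderive_continuous _ _ _ (is_Cderive_quartic t _)).
      - apply (@continuous_ext C_UniformSpace R_UniformSpace
                 (fun w : C => @norm R_AbsRing C_R_NormedModule w)).
        + intros w. symmetry. apply Cmod_norm.
        + apply (@filterlim_norm R_AbsRing C_R_NormedModule). }
    destruct (continuity_ab_min (fun s : R => Cmod (quartic t (RtoC s * z)%C)) 0 1)
      as [s0 [Hmin Hs0]]; [lra| |].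
    { intros s _. apply continuity_pt_filterlim. apply Hcont. }
    assert (Hm : 0 < Cmod (quartic t (RtoC s0 * z)%C)) by (apply Cmod_gt_0, Hz, Hs0).
    set (m := Cmod (quartic t (RtoC s0 * z)%C)) in *.
    set (M := Cmod z + 1). assert (HM : 1 <= M) by (pose proof (Cmod_ge_0 z); unfold M; lra).
    set (K := 2 * M * (2 * M ^ 2 + 2)).
    assert (HK : 0 < K) by (unfold K; simpl; nra).
    apply locally_Cmod. exists (Rmin 1 (m / K)).
    assert (HmK : 0 < m / K) by (apply Rdiv_lt_0_compat; assumption).
    split; [apply Rmin_pos; lra|].
    intros w Hw s Hs E.
    pose proof (Rmin_l 1 (m / K)). pose proof (Rmin_r 1 (m / K)).
    assert (Hsc : forall u : C, Cmod (RtoC s * u) <= Cmod u).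
    { intros u. rewrite Cmod_mult, Cmod_R, Rabs_pos_eq by lra.
      pose proof (Cmod_ge_0 u). nra. }
    assert (Hzw : Cmod w <= M).
    { replace w with (z + (w - z))%C by ring.
      eapply Rle_trans; [apply Cmod_triangle|]. unfold M. lra. }
    pose proof (quartic_bound t M (RtoC s * w) (RtoC s * z)) as Hb. fold K in Hb.
    rewrite E in Hb.
    replace (quartic t (RtoC s * z) - 0)%C with (quartic t (RtoC s * z)) in Hb by ring.
    specialize (Hb ltac:(eapply Rle_trans; [apply Hsc|lra])
                   ltac:(eapply Rle_trans; [apply Hsc|unfold M; lra])).
    specialize (Hmin s Hs). fold m in Hmin.
    assert (Hd : Cmod (RtoC s * z - RtoC s * w) <= Cmod (w - z)).
    { replace (RtoC s * z - RtoC s * w)%C with (RtoC s * (- (w - z)))%C by ring.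
      eapply Rle_trans; [apply Hsc|]. rewrite Cmod_opp. lra. }
    assert (K * Cmod (w - z) < m).
    { replace m with (K * (m / K)) by (field; lra).
      apply Rmult_lt_compat_l; lra. }
    nra.
  - intros z Hz s Hs s' Hs'.
    rewrite Cmult_assoc, <- RtoC_mult. apply Hz. nra.
Qed.

Lemma sin_2t_pos (t : R) : 0 < t < PI / 2 -> 0 < sin (2 * t).
Proof. intros H. apply sin_gt_0; lra. Qed.

Lemma Cmod_unit_a (t : R) : Cmod (unit_a t) = 1.
Proof.
  rewrite unit_a_eq. unfold Cmod. simpl.
  pose proof (sin2_cos2 t) as H. unfold Rsqr in H.
  replace (_ + _) with 1 by lra. apply sqrt_1.
Qed.

(** The zeros of the quartic are on the unit circle. *)
Lemma quartic_disk_neq_0 (t : R) (z : C) : in_disk z -> quartic t z <> RtoC 0.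
Proof.
  unfold in_disk. intros Hz. rewrite quartic_factor.
  assert (H : forall a : C, Cmod a = 1 -> (z ^ 2 - a ^ 2 <> 0)%C).
  { intros a Ha E.
    assert (E' : (z ^ 2)%C = (a ^ 2)%C).
    { replace (z ^ 2)%C with (z ^ 2 - a ^ 2 + a ^ 2)%C by ring. rewrite E. ring. }
    apply (f_equal Cmod) in E'. simpl in E'. rewrite !Cmod_mult, Ha, Cmod_1 in E'.
    pose proof (Cmod_ge_0 z). nra. }
  apply Cmult_neq_0; apply H; [|rewrite Cmod_conj]; apply Cmod_unit_a.
Qed.

Lemma star_domain_disk (t : R) (z : C) : in_disk z -> star_domain t z.
Proof.
  intros Hz s Hs. apply quartic_disk_neq_0. unfold in_disk in *.
  rewrite Cmod_mult, Cmod_R, Rabs_pos_eq by lra. pose proof (Cmod_ge_0 z). nra.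
Qed.

Lemma star_domain_1 (t : R) : 0 < t < PI / 2 -> star_domain t (RtoC 1).
Proof.
  intros Ht s Hs. rewrite Cmult_1_r, quartic_RtoC. intros E. injection E as E.
  pose proof (pow_lt _ 2 (sin_2t_pos t Ht)).
  pose proof (pow2_ge_0 (s ^ 2 - cos (2 * t))). lra.
Qed.

(** * Logarithm and powers of the quartic, and the functions [f_inf] and [y_inf] *)

Definition quartic_log (t : R) : C -> C :=
  segment_integral (fun w => quartic' t w / quartic t w)%C.

Definition quartic_exp (t beta : R) (z : C) : C :=
  Cexp (RtoC beta * quartic_log t z).

Lemma star_domain_neq_0 (t : R) (z : C) : star_domain t z -> quartic t z <> RtoC 0.
Proof.
  intros Hz. replace z with (RtoC 1 * z)%C by ring. apply Hz. lra.
Qed.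

Lemma quartic_log_spec (t : R) (z : C) : star_domain t z ->
  is_Cderive (quartic_log t) z (quartic' t z / quartic t z)%C /\
  Cexp (quartic_log t z) = quartic t z.
Proof.
  apply (segment_integral_log (star_domain t) (quartic t) (quartic' t) (quartic'' t)).
  - apply open_star_star_domain.
  - intros w _. apply is_Cderive_quartic.
  - intros w _. apply is_Cderive_quartic'.
  - intros w _. apply continuous_quartic''.
  - apply star_domain_neq_0.
  - unfold quartic. simpl. ring.
Qed.

Lemma continuous_quartic_log (t : R) (z : C) : star_domain t z ->
  C_continuous (quartic_log t) z.
Proof.
  intros Hz. exact (is_Cderive_continuous _ _ _ (proj1 (quartic_log_spec t z Hz))).
Qed.

Lemma is_Cderive_quartic_exp (t beta : R) (z : C) : star_domain t z ->
  is_Cderive (quartic_exp t beta) z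
    (RtoC beta * (quartic' t z / quartic t z) * quartic_exp t beta z)%C.
Proof.
  intros Hz. apply (is_Cderive_Cexp_comp (fun w => RtoC beta * quartic_log t w)%C).
  apply is_Cderive_scal, quartic_log_spec, Hz.
Qed.

Lemma is_Cderive_quartic_log_derivative (t : R) (z : C) : star_domain t z ->
  is_Cderive (fun w => quartic' t w / quartic t w)%C z
    ((quartic'' t z * quartic t z - quartic' t z * quartic' t z) / quartic t z ^ 2)%C.
Proof.
  intros Hz. apply is_Cderive_div.
  - apply star_domain_neq_0, Hz.
  - apply is_Cderive_quartic'.
  - apply is_Cderive_quartic.
Qed.

Lemma is_Cderive_quartic_exp' (t beta : R) (z : C) : star_domain t z ->
  is_Cderive
    (fun w => RtoC beta * (quartic' t w / quartic t w) * quartic_exp t beta w)%C z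
    (RtoC beta * ((quartic'' t z * quartic t z - quartic' t z * quartic' t z)
                  / quartic t z ^ 2) * quartic_exp t beta z
     + RtoC beta * (quartic' t z / quartic t z)
       * (RtoC beta * (quartic' t z / quartic t z) * quartic_exp t beta z))%C.
Proof.
  intros Hz.
  apply (is_Cderive_mult (fun w => RtoC beta * (quartic' t w / quartic t w))%C).
  - apply (is_Cderive_scal _ (fun w => quartic' t w / quartic t w)%C).
    apply is_Cderive_quartic_log_derivative, Hz.
  - apply is_Cderive_quartic_exp, Hz.
Qed.

Lemma quartic_power_exp (t alpha : R) (z : C) : star_domain t z ->
  quartic_power t alpha z = quartic_exp t alpha z.
Proof.
  apply power_branch_eq.
  - apply open_star_star_domain.
  - apply continuous_quartic_log.
  - intros w Hw. apply quartic_log_spec, Hw.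
  - apply segment_integral_0.
Qed.

(** The functions chosen by [power_branch] are known on the star domain only; this
    lemma transports derivatives to them from explicit functions. *)
Lemma is_Cderive_congr (U : C -> Prop) (f g : C -> C) (z l : C) :
  open_star U -> (forall w, U w -> f w = g w) -> U z ->
  is_Cderive g z l -> is_Cderive f z l.
Proof.
  intros HU E Hz. apply is_Cderive_ext_loc.
  apply (filter_imp (F := @locally C_UniformSpace z) U); [|apply HU, Hz].
  intros w Hw. symmetry. apply E, Hw.
Qed.

Lemma is_Cderive_f_inf (t : R) (z : C) : star_domain t z ->
  is_Cderive (f_inf t) z (quartic_exp t (- (1 / 2)) z).
Proof.
  intros Hz. rewrite <- quartic_power_exp by exact Hz.
  apply (segment_integral_primitive (star_domain t) _
    (fun w => RtoC (- (1 / 2)) * (quartic' t w / quartic t w)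
              * quartic_exp t (- (1 / 2)) w)%C).
  - apply open_star_star_domain.
  - intros w Hw. apply (is_Cderive_congr (star_domain t) _ (quartic_exp t (- (1 / 2)))).
    + apply open_star_star_domain.
    + apply quartic_power_exp.
    + exact Hw.
    + apply is_Cderive_quartic_exp, Hw.
  - intros w Hw. exact (is_Cderive_continuous _ _ _ (is_Cderive_quartic_exp' t _ w Hw)).
  - exact Hz.
Qed.

Lemma C_derive_f_inf (t : R) (z : C) : star_domain t z ->
  C_derive (f_inf t) z = quartic_exp t (- (1 / 2)) z.
Proof. intros Hz. apply is_C_derive_unique, is_Cderive_f_inf, Hz. Qed.

Lemma is_Cderive_C_derive_f_inf (t : R) (z : C) : star_domain t z ->
  is_Cderive (C_derive (f_inf t)) z
    (RtoC (- (1 / 2)) * (quartic' t z / quartic t z) * quartic_exp t (- (1 / 2)) z)%C.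
Proof.
  intros Hz. apply (is_Cderive_congr (star_domain t) _ (quartic_exp t (- (1 / 2)))).
  - apply open_star_star_domain.
  - apply C_derive_f_inf.
  - exact Hz.
  - apply is_Cderive_quartic_exp, Hz.
Qed.

(** The logarithm [- L / 2] of [f_inf'] vanishes at [0], and
    [(- 1 / 2) (- 1 / 2) = 1 / 4]. *)
Lemma y_inf_exp (t : R) (z : C) : star_domain t z ->
  y_inf t z = quartic_exp t (1 / 4) z.
Proof.
  intros Hz. unfold y_inf.
  rewrite (power_branch_eq (star_domain t) (C_derive (f_inf t))
             (fun w => RtoC (- (1 / 2)) * quartic_log t w)%C).
  - unfold quartic_exp. f_equal. rewrite Cmult_assoc, <- RtoC_mult.
    do 2 f_equal. field.
  - apply open_star_star_domain.
  - intros w Hw. apply (continuous_Cmult (T := C_UniformSpace) (fun _ => RtoC _));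
      [apply continuous_const|apply continuous_quartic_log, Hw].
  - intros w Hw. symmetry. apply C_derive_f_inf, Hw.
  - unfold quartic_log. rewrite segment_integral_0. ring.
  - exact Hz.
Qed.

Lemma is_Cderive_y_inf (t : R) (z : C) : star_domain t z ->
  is_Cderive (y_inf t) z
    (RtoC (1 / 4) * (quartic' t z / quartic t z) * quartic_exp t (1 / 4) z)%C.
Proof.
  intros Hz. apply (is_Cderive_congr (star_domain t) _ (quartic_exp t (1 / 4))).
  - apply open_star_star_domain.
  - apply y_inf_exp.
  - exact Hz.
  - apply is_Cderive_quartic_exp, Hz.
Qed.

Lemma is_Cderive_C_derive_y_inf (t : R) (z : C) : star_domain t z ->
  is_Cderive (C_derive (y_inf t)) z
    (RtoC (1 / 4) * ((quartic'' t z * quartic t z - quartic' t z * quartic' t z)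
                  / quartic t z ^ 2) * quartic_exp t (1 / 4) z
     + RtoC (1 / 4) * (quartic' t z / quartic t z)
       * (RtoC (1 / 4) * (quartic' t z / quartic t z) * quartic_exp t (1 / 4) z))%C.
Proof.
  intros Hz. eapply (is_Cderive_congr (star_domain t)).
  - apply open_star_star_domain.
  - intros w Hw. apply is_C_derive_unique, is_Cderive_y_inf, Hw.
  - exact Hz.
  - apply is_Cderive_quartic_exp', Hz.
Qed.

(** The value [cot 2t / 4] of lambda cancels the factor [sin 2t] of [psi1].  Times
    [q ^ 2], both sides are [2 c z ^ 4 + (2 c ^ 2 - 6) z ^ 2 + 2 c] with
    [c = cos 2t]. *)
Lemma R_function_quartic (t : R) (z : C) : 0 < t < PI / 2 -> quartic t z <> RtoC 0 ->
  R_function t (lambda_inf t) z =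
  (- (1 / 2) * ((quartic'' t z * quartic t z - quartic' t z * quartic' t z)
                / quartic t z ^ 2)
   - 1 / 8 * (quartic' t z / quartic t z) ^ 2)%C.
Proof.
  intros Ht H. unfold R_function, lambda_inf.
  rewrite psi0_quartic, psi1_quartic by exact H.
  pose proof (sin_2t_pos t Ht) as Hs.
  rewrite RtoC_mult, !RtoC_div by lra.
  assert (Hs' : RtoC (sin (2 * t)) <> RtoC 0) by (intros E; injection E; lra).
  set (q := quartic t z) in *.
  assert (Eq : q = quartic t z) by reflexivity. clearbody q.
  unfold quartic in Eq. unfold quartic', quartic''.
  set (c := RtoC (cos (2 * t))) in *. set (s := RtoC (sin (2 * t))) in *.
  clearbody c s.
  field_simplify_eq; [rewrite Eq; ring|split; assumption].
Qed.

Lemma Schwarzian_f_inf (t : R) (z : C) : star_domain t z ->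
  schwarzian (f_inf t) z =
  (- (1 / 2) * ((quartic'' t z * quartic t z - quartic' t z * quartic' t z)
                / quartic t z ^ 2)
   - 1 / 8 * (quartic' t z / quartic t z) ^ 2)%C.
Proof.
  intros Hz.
  assert (E : forall w, star_domain t w ->
    (C_derive (C_derive (f_inf t)) w / C_derive (f_inf t) w
     = RtoC (- (1 / 2)) * (quartic' t w / quartic t w))%C).
  { intros w Hw. rewrite C_derive_f_inf by exact Hw.
    rewrite (is_C_derive_unique _ _ _ (is_Cderive_C_derive_f_inf t w Hw)).
    unfold Cdiv at 1. rewrite <- Cmult_assoc, Cinv_r, Cmult_1_r by apply Cexp_neq_0.
    reflexivity. }
  unfold schwarzian. rewrite E by exact Hz.
  rewrite (is_C_derive_unique _ z (RtoC (- (1 / 2))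
    * ((quartic'' t z * quartic t z - quartic' t z * quartic' t z)
       / quartic t z ^ 2))%C).
  - rewrite RtoC_opp, RtoC_div by lra.
    field. apply star_domain_neq_0, Hz.
  - apply (is_Cderive_congr (star_domain t) _
             (fun w => RtoC (- (1 / 2)) * (quartic' t w / quartic t w))%C).
    + apply open_star_star_domain.
    + exact E.
    + exact Hz.
    + apply is_Cderive_scal, is_Cderive_quartic_log_derivative, Hz.
Qed.

(** * Values at [1] *)

(** The integrand [q' / q] is real on [[0, 1]], so the integral is; its exponential
    is [q 1 = (1 - cos 2t) ^ 2 + sin 2t ^ 2 = 4 sin t ^ 2]. *)
Lemma quartic_log_1 (t : R) : 0 < t < PI / 2 ->
  exists x : R, quartic_log t (RtoC 1) = RtoC x /\ exp x = (2 * sin t) ^ 2.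
Proof.
  intros Ht. pose proof (star_domain_1 t Ht) as H1.
  pose (g := fun s : R => (quartic' t (RtoC s * 1) / quartic t (RtoC s * 1))%C).
  set (I := RInt (V := C_R_CompleteNormedModule) g 0 1).
  assert (HL : quartic_log t (RtoC 1) = I) by apply Cmult_1_l.
  assert (Hg : forall s : R, 0 <= s <= 1 ->
            @continuous R_UniformSpace C_UniformSpace g s).
  { intros s Hs.
    apply (continuous_comp (U := R_UniformSpace) (V := C_UniformSpace)
             (fun s : R => RtoC s * 1)%C (fun w => quartic' t w / quartic t w)%C).
    - apply continuous_ray.
    - eapply is_Cderive_continuous, is_Cderive_quartic_log_derivative.
      apply open_star_star_domain; assumption. }
  assert (Him : snd I = 0).
  { replace (snd I) with (fst (- Ci * I)%C) by (simpl; ring).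
    rewrite <- (is_RInt_unique (V := R_CompleteNormedModule) _ _ _ _
                  (Re_Cmult_RInt (- Ci) g Hg) : _ = fst (- Ci * I)%C).
    rewrite (RInt_ext _ (fun _ => 0)).
    - rewrite RInt_const. unfold scal; simpl. unfold mult; simpl. ring.
    - intros s _. unfold g. rewrite Cmult_1_r, quartic_RtoC.
      replace (quartic' t (RtoC s)) with (RtoC (4 * s ^ 3 - 4 * cos (2 * t) * s)).
      + rewrite <- RtoC_div.
        * simpl. ring.
        * pose proof (pow_lt _ 2 (sin_2t_pos t Ht)).
          pose proof (pow2_ge_0 (s ^ 2 - cos (2 * t))). lra.
      + unfold quartic'. apply injective_projections; simpl; ring. }
  clearbody I. exists (fst I).
  assert (HI : I = RtoC (fst I)) by (apply injective_projections; [reflexivity|exact Him]).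
  split; [rewrite HL; exact HI|].
  pose proof (proj2 (quartic_log_spec t _ H1)) as HE.
  rewrite HL, HI, Cexp_RtoC, quartic_RtoC in HE. injection HE as HE.
  rewrite HE, cos_2a_sin, sin_2a. pose proof (sin2_cos2 t) as H. unfold Rsqr in H.
  simpl.
  replace ((2 * sin t * cos t) * (2 * sin t * cos t * 1))
    with (4 * (sin t * sin t) * (cos t * cos t)) by ring.
  replace (cos t * cos t) with (1 - sin t * sin t) by lra. ring.
Qed.

Lemma y_inf_1 (t : R) : 0 < t < PI / 2 ->
  y_inf t (RtoC 1) = RtoC (sqrt (2 * sin t)).
Proof.
  intros Ht. rewrite y_inf_exp by (apply star_domain_1, Ht).
  assert (Hs : 0 < sin t) by (apply sin_gt_0; lra).
  destruct (quartic_log_1 t Ht) as [x [Hx He]].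
  unfold quartic_exp. rewrite Hx, <- RtoC_mult, Cexp_RtoC. f_equal.
  symmetry. apply sqrt_lem_1; [lra|left; apply exp_pos|].
  apply Rsqr_inj; [left; apply Rmult_lt_0_compat; apply exp_pos|lra|].
  unfold Rsqr. replace (2 * sin t * (2 * sin t)) with ((2 * sin t) ^ 2) by ring.
  rewrite <- He, <- !exp_plus. f_equal. field.
Qed.

Lemma C_derive_y_inf_1 (t : R) : 0 < t < PI / 2 ->
  C_derive (y_inf t) (RtoC 1) = (RtoC (1 / 2) * y_inf t (RtoC 1))%C.
Proof.
  intros Ht. pose proof (star_domain_1 t Ht) as H1.
  rewrite (is_C_derive_unique _ _ _ (is_Cderive_y_inf t _ H1)), <- y_inf_exp by exact H1.
  f_equal.
  assert (E : quartic' t (RtoC 1) = (RtoC 2 * quartic t (RtoC 1))%C)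
    by (unfold quartic, quartic'; apply injective_projections; simpl; ring).
  rewrite E, !RtoC_div by lra.
  field. apply star_domain_neq_0, H1.
Qed.

(** * The theorem *)

Theorem mainTheorem2 (t : R) (ht : 0 < t < PI / 2) :
  (* [f_inf] is holomorphic and locally univalent, and its Schwarzian is [R] *)
  (forall z : C, in_disk z ->
     C_differentiable_at (f_inf t) z /\ C_derive (f_inf t) z <> RtoC 0) /\
  (forall z : C, in_disk z ->
     schwarzian (f_inf t) z = R_function t (lambda_inf t) z) /\
  (* [y_inf], defined as [(f_inf') ^ (-1/2)], is [quartic ^ (1/4)] *)
  (forall z : C, in_disk z \/ z = RtoC 1 ->
     C_differentiable_at (y_inf t) z /\ y_inf t z = quartic_power t (1 / 4) z) /\
  (forall z : C, in_disk z -> y_inf t z <> RtoC 0) /\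
  (forall z : C, in_disk z ->
     C_differentiable_at (C_derive (y_inf t)) z /\
     (C_derive (C_derive (y_inf t)) z + psi0 t z * y_inf t z
      = RtoC (lambda_inf t) * psi1 t z * y_inf t z)%C) /\
  y_inf t (RtoC 0) = RtoC 1 /\
  C_derive (y_inf t) (RtoC 0) = RtoC 0 /\
  y_inf t (RtoC 1) = RtoC (sqrt (2 * sin t)) /\
  C_derive (y_inf t) (RtoC 1) = RtoC (sqrt (sin t / 2)) /\
  (y_inf t (RtoC 1) ^ 2 - 2 * y_inf t (RtoC 1) * C_derive (y_inf t) (RtoC 1))%C
  = RtoC kappa_inf.
Proof.
  assert (H0 : star_domain t (RtoC 0)).
  { apply star_domain_disk. unfold in_disk. rewrite Cmod_0. lra. }
  repeat split.
  - exists (quartic_exp t (- (1 / 2)) z). apply is_Cderive_f_inf, star_domain_disk, H.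
  - rewrite C_derive_f_inf by (apply star_domain_disk, H). apply Cexp_neq_0.
  - intros z Hz. apply star_domain_disk with (t := t) in Hz.
    rewrite R_function_quartic; [apply Schwarzian_f_inf, Hz|exact ht|].
    apply star_domain_neq_0, Hz.
  - eexists. apply is_Cderive_y_inf.
    destruct H as [H | ->]; [apply star_domain_disk, H|apply star_domain_1, ht].
  - assert (Hz : star_domain t z).
    { destruct H as [H | ->]; [apply star_domain_disk, H|apply star_domain_1, ht]. }
    rewrite y_inf_exp, quartic_power_exp by exact Hz. reflexivity.
  - intros z Hz. rewrite y_inf_exp by (apply star_domain_disk, Hz). apply Cexp_neq_0.
  - eexists. apply is_Cderive_C_derive_y_inf, star_domain_disk, H.
  - apply star_domain_disk with (t := t) in H.
    pose proof (star_domain_neq_0 t z H) as Hq.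
    rewrite (is_C_derive_unique _ _ _ (is_Cderive_C_derive_y_inf t z H)), y_inf_exp
      by exact H.
    (* The equation for [y_inf] is [y'' = - (S / 2) y] once [psi0] is expressed
       through [R_function]. *)
    pose proof (R_function_quartic t z ht Hq) as HR. unfold R_function in HR.
    replace (psi0 t z) with (RtoC (lambda_inf t) * psi1 t z
      + / 2 * (2 * psi0 t z - 2 * RtoC (lambda_inf t) * psi1 t z))%C
      by field.
    rewrite HR, RtoC_div by lra.
    field. assumption.
  - rewrite y_inf_exp by exact H0. unfold quartic_exp, quartic_log.
    rewrite segment_integral_0, Cmult_0_r. apply Cexp_0.
  - rewrite (is_C_derive_unique _ _ _ (is_Cderive_y_inf t _ H0)).
    replace (quartic' t (RtoC 0)) with (RtoC 0) by (unfold quartic'; simpl; ring).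
    unfold Cdiv. ring.
  - apply y_inf_1, ht.
  - rewrite C_derive_y_inf_1, y_inf_1, <- RtoC_mult by exact ht. f_equal.
    assert (Hs : 0 < sin t) by (apply sin_gt_0; lra).
    pose proof (sqrt_pos (2 * sin t)). symmetry. apply sqrt_lem_1; [lra|lra|].
    pose proof (sqrt_sqrt (2 * sin t)). nra.
  - rewrite C_derive_y_inf_1, RtoC_div by (exact ht || lra).
    unfold kappa_inf. field.
Qed.
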